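(* Let $R$ be a commutative ring with identity. The following conditions are equivalent: (1) $R$ is semiregular; (2) each finitely presented $R$-module is contained in a free module (i.e. embeds in a free $R$-module); (3) each finitely presented cyclic $R$-module is contained in a free module (i.e. embeds in a free $R$-module); (4) $R$ is coherent and $(0:(0:I))=I$ for each finitely generated ideal $I$ of $R$.
   Context: All rings are commutative with identity and all modules are unitary. $R$ is semiregular if every $R$-module embeds into a flat $R$-module. $R$ is coherent if every finitely generated ideal is finitely presented. For an ideal $I$, $(0:I)=\{r\in R: rI=0\}$. *)

(* Defs.v *)
From HB Require Import structures.
From mathcomp Require Import all_boot all_order all_algebra.
From mathcomp Require Import generic_quotient.
From mathcomp Require Import boolp classical_sets.

Set Implicit Arguments.
Unset Strict Implicit.
Unset Printing Implicit Defensive.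

Import GRing.Theory.

Local Open Scope quotient_scope.
Local Open Scope ring_scope.

(* Rings are [comPzRingType], so that the zero ring is allowed. *)

Section Tensor.
Variables (R : comPzRingType) (M N : lmodType R).

(* A list of pairs (m_i, n_i) stands for the formal sum of the m_i (x) n_i;
   [tens_eq] is the least congruence of the monoid of lists making
   concatenation commutative and (x) bilinear. *)
Inductive tens_eq : seq (M * N) -> seq (M * N) -> Prop :=
| tens_refl s : tens_eq s s
| tens_sym s t : tens_eq s t -> tens_eq t s
| tens_trans s t u : tens_eq s t -> tens_eq t u -> tens_eq s u
| tens_cat s s' t t' : tens_eq s s' -> tens_eq t t' ->
    tens_eq (s ++ t) (s' ++ t')
| tens_catC s t : tens_eq (s ++ t) (t ++ s)
| tens_0l n : tens_eq [:: (0, n)] [::]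
| tens_Dl m m' n : tens_eq [:: (m + m', n)] [:: (m, n); (m', n)]
| tens_Dr m n n' : tens_eq [:: (m, n + n')] [:: (m, n); (m, n')]
| tens_Z a m n : tens_eq [:: (a *: m, n)] [:: (m, a *: n)].

Definition tens_rel : rel (seq (M * N)) := fun s t => `[< tens_eq s t >].

Lemma tens_rel_refl : reflexive tens_rel.
Proof. by move=> s; apply/asboolP/tens_refl. Qed.

Lemma tens_rel_sym : symmetric tens_rel.
Proof. by move=> s t; apply/asboolP/asboolP => /tens_sym. Qed.

Lemma tens_rel_trans : transitive tens_rel.
Proof.
by move=> t s u /asboolP st /asboolP tu; apply/asboolP/(tens_trans st tu).
Qed.

Canonical tens_equiv := EquivRel tens_rel tens_rel_refl tens_rel_sym tens_rel_trans.

Definition tensor := {eq_quot tens_equiv}.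
HB.instance Definition _ := Choice.on tensor.

Definition tpi (s : seq (M * N)) : tensor := \pi_tensor s.

Definition pure (m : M) (n : N) : tensor := tpi [:: (m, n)].

Lemma tpiP s t : tpi s = tpi t <-> tens_eq s t.
Proof.
by split=> [/eqmodP/asboolP|st]; last by apply/eqmodP/asboolP.
Qed.

Lemma tpiK (x : tensor) : tpi (repr x) = x.
Proof. exact: reprK. Qed.

Lemma tens_repr s : tens_eq (repr (tpi s)) s.
Proof. by apply/tpiP; rewrite tpiK. Qed.

Definition tscale_seq (a : R) (s : seq (M * N)) := [seq (a *: p.1, p.2) | p <- s].

Lemma tscale_seq_eq a s t : tens_eq s t -> tens_eq (tscale_seq a s) (tscale_seq a t).
Proof.
rewrite /tscale_seq; elim=> {s t} //=.
- by move=> s; exact: tens_refl.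
- by move=> s t _; exact: tens_sym.
- by move=> s t u _ st _; exact: tens_trans.
- by move=> s s' t t' _ ss' _ tt'; rewrite !map_cat; exact: tens_cat.
- by move=> s t; rewrite !map_cat; exact: tens_catC.
- by move=> n; rewrite scaler0; exact: tens_0l.
- by move=> m m' n; rewrite scalerDr; exact: tens_Dl.
- by move=> m n n'; exact: tens_Dr.
- by move=> b m n; rewrite scalerA mulrC -scalerA; exact: tens_Z.
Qed.

Definition tadd (x y : tensor) := tpi (repr x ++ repr y).
Definition tscale (a : R) (x : tensor) := tpi (tscale_seq a (repr x)).

Lemma taddE s t : tadd (tpi s) (tpi t) = tpi (s ++ t).
Proof. by apply/tpiP/tens_cat; exact: tens_repr. Qed.

Lemma tscaleE a s : tscale a (tpi s) = tpi (tscale_seq a s).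
Proof. exact/tpiP/tscale_seq_eq/tens_repr. Qed.

Lemma taddA : associative tadd.
Proof.
move=> x y z; rewrite -(tpiK x) -(tpiK y) -(tpiK z).
by rewrite !taddE catA.
Qed.

Lemma taddC : commutative tadd.
Proof.
move=> x y; rewrite -(tpiK x) -(tpiK y) !taddE.
exact/tpiP/tens_catC.
Qed.

Lemma tadd0 : left_id (tpi [::]) tadd.
Proof. by move=> x; rewrite -(tpiK x) taddE. Qed.

Lemma taddN : left_inverse (tpi [::]) (tscale (-1)) tadd.
Proof.
move=> x; rewrite -(tpiK x) tscaleE taddE; move: (repr x) => {x} s.
elim: s => [//|[m n] s /tpiP IHs]; apply/tpiP.
apply: (@tens_trans _ ([:: (-1 *: m, n); (m, n)] ++ (tscale_seq (-1) s ++ s))).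
  apply: (@tens_cat [:: (-1 *: m, n)] [:: (-1 *: m, n)]
            (tscale_seq (-1) s ++ [:: (m, n)] ++ s)
            ([:: (m, n)] ++ tscale_seq (-1) s ++ s)); first exact: tens_refl.
  rewrite !catA; apply: tens_cat; last exact: tens_refl.
  exact: tens_catC.
rewrite -[[::]]cats0; apply: tens_cat IHs.
apply: tens_trans (tens_sym (tens_Dl _ _ _)) _.
by rewrite scaleN1r addNr; exact: tens_0l.
Qed.

HB.instance Definition _ := GRing.isZmodule.Build tensor taddA taddC tadd0 taddN.

Lemma tpi_cat s t : tpi (s ++ t) = tpi s + tpi t.
Proof. by rewrite -taddE. Qed.

Lemma tscaleA a b x : tscale a (tscale b x) = tscale (a * b) x.
Proof.
rewrite -(tpiK x) !tscaleE; congr tpi; rewrite /tscale_seq -map_comp.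
by apply: eq_map => p /=; rewrite scalerA.
Qed.

Lemma tscale1 : left_id 1 tscale.
Proof.
move=> x; rewrite -[RHS](tpiK x) -{1}(tpiK x) tscaleE; congr tpi.
by rewrite -[RHS]map_id; apply: eq_map => -[m n] /=; rewrite scale1r.
Qed.

Lemma tscaleDr : right_distributive tscale +%R.
Proof.
move=> a x y; rewrite -(tpiK x) -(tpiK y) -tpi_cat !tscaleE -tpi_cat.
by rewrite /tscale_seq map_cat.
Qed.

Lemma tscaleDl x : {morph tscale^~ x : a b / a + b}.
Proof.
move=> a b; rewrite -(tpiK x) !tscaleE; move: (repr x) => {x} s.
elim: s => [|[m n] s IHs]; first by rewrite addr0.
have E c : tpi (tscale_seq c ((m, n) :: s)) =
    tpi [:: (c *: m, n)] + tpi (tscale_seq c s) by rewrite -tpi_cat.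
rewrite !E IHs scalerDl addrACA; congr (_ + _).
by rewrite -tpi_cat; apply/tpiP/tens_Dl.
Qed.

HB.instance Definition _ :=
  GRing.Zmodule_isLmodule.Build R tensor tscaleA tscale1 tscaleDr tscaleDl.

Lemma tpi_sum s : tpi s = \sum_(p <- s) pure p.1 p.2.
Proof.
elim: s => [|[m n] s IHs]; first by rewrite big_nil.
by rewrite big_cons -IHs -tpi_cat.
Qed.

Definition bilinear_map (P : lmodType R) (b : M -> N -> P) :=
  (forall n, linear (b^~ n)) /\ (forall m, linear (b m)).

Lemma pure_linearl n : linear (pure^~ n).
Proof.
move=> a m m'; rewrite [a *: pure m n]tscaleE -tpi_cat.
exact/tpiP/tens_Dl.
Qed.

Lemma pure_linearr m : linear (pure m).
Proof.
move=> a n n'; rewrite [a *: pure m n]tscaleE -tpi_cat.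
apply/tpiP/(tens_trans (tens_Dr _ _ _)).
apply: (@tens_cat [:: (m, a *: n)] [:: (a *: m, n)] [:: (m, n')] [:: (m, n')]).
  exact/tens_sym/tens_Z.
exact: tens_refl.
Qed.

Lemma pure_bilinear : bilinear_map pure.
Proof. by split; [exact: pure_linearl|exact: pure_linearr]. Qed.

Definition tensor_lift (P : lmodType R) (b : M -> N -> P) (x : tensor) : P :=
  \sum_(p <- repr x) b p.1 p.2.

Section UniversalProperty.
Variables (P : lmodType R) (b : M -> N -> P).
Hypothesis b_bilinear : bilinear_map b.

Let bl n : {linear M -> P} :=
  HB.pack (b^~ n) (GRing.isLinear.Build R M P *:%R (b^~ n) (b_bilinear.1 n)).
Let br m : {linear N -> P} :=
  HB.pack (b m) (GRing.isLinear.Build R N P *:%R (b m) (b_bilinear.2 m)).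

Lemma tens_eq_lift s t : tens_eq s t ->
  \sum_(p <- s) b p.1 p.2 = \sum_(p <- t) b p.1 p.2.
Proof.
elim=> {s t} //=.
- by move=> s t u _ -> _ ->.
- by move=> s s' t t' _ ss' _ tt'; rewrite !big_cat /= ss' tt'.
- by move=> s t; rewrite !big_cat /= addrC.
- by move=> n; rewrite big_cons !big_nil addr0; exact: (raddf0 (bl n)).
- move=> m m' n; rewrite !big_cons !big_nil !addr0; exact: (raddfD (bl n)).
- move=> m n n'; rewrite !big_cons !big_nil !addr0; exact: (raddfD (br m)).
- move=> a m n; rewrite !big_cons !big_nil !addr0 /=.
  by rewrite [LHS](linearZ_LR (bl n)) [RHS](linearZ_LR (br m)).
Qed.

Lemma tensor_lift_tpi s : tensor_lift b (tpi s) = \sum_(p <- s) b p.1 p.2.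
Proof. exact/tens_eq_lift/tens_repr. Qed.

Lemma tensor_lift_pure m n : tensor_lift b (pure m n) = b m n.
Proof. by rewrite tensor_lift_tpi big_cons big_nil addr0. Qed.

Lemma tensor_lift_linear : linear (tensor_lift b).
Proof.
move=> a x y; rewrite -(tpiK x) -(tpiK y) [a *: _]tscaleE -tpi_cat.
rewrite !tensor_lift_tpi big_cat big_map scaler_sumr; congr (_ + _).
by apply: eq_bigr => p _; rewrite /= [LHS](linearZ_LR (bl p.2)).
Qed.

Lemma tensor_lift_unique (g : {linear tensor -> P}) :
  (forall m n, g (pure m n) = b m n) -> g =1 tensor_lift b.
Proof.
move=> gb x; rewrite -(tpiK x) tensor_lift_tpi tpi_sum raddf_sum.
by apply: eq_bigr => p _; exact: gb.
Qed.

End UniversalProperty.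
End Tensor.

Arguments pure {R M N} m n.

Section ModuleNotions.
Variable R : comPzRingType.

(* id_M (x) f; see [tensor_map_pure] and [tensor_map_linear]. *)
Definition tensor_map (M A B : lmodType R) (f : {linear A -> B}) :
    tensor M A -> tensor M B :=
  tensor_lift (fun m x => pure m (f x)).

Lemma tensor_map_bilinear (M A B : lmodType R) (f : {linear A -> B}) :
  bilinear_map (fun (m : M) x => pure m (f x)).
Proof.
split=> [x|m] a u v; first exact: pure_linearl.
by rewrite linearP; exact: pure_linearr.
Qed.

Lemma tensor_map_pure (M A B : lmodType R) (f : {linear A -> B}) (m : M) x :
  tensor_map f (pure m x) = pure m (f x).
Proof. exact/tensor_lift_pure/tensor_map_bilinear. Qed.

Lemma tensor_map_linear (M A B : lmodType R) (f : {linear A -> B}) :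
  linear (@tensor_map M A B f).
Proof. exact/tensor_lift_linear/tensor_map_bilinear. Qed.

Definition flat (M : lmodType R) : Prop :=
  forall (A B : lmodType R) (f : {linear A -> B}),
    injective f -> injective (@tensor_map M A B f).

Definition embeds (M N : lmodType R) : Prop :=
  exists f : {linear M -> N}, injective f.

Definition semiregular : Prop :=
  forall M : lmodType R, exists2 F : lmodType R, flat F & embeds M F.

Definition is_basis (M : lmodType R) (B : set M) : Prop :=
  (forall x : M, exists (s : seq M) (c : M -> R),
     (forall v, v \in s -> B v) /\ x = \sum_(v <- s) c v *: v) /\
  (forall (s : seq M) (c : M -> R),
     uniq s -> (forall v, v \in s -> B v) ->
     \sum_(v <- s) c v *: v = 0 -> forall v, v \in s -> c v = 0).

Definition free_module (M : lmodType R) : Prop := exists B : set M, is_basis B.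

Definition embeds_in_free (M : lmodType R) : Prop :=
  exists2 F : lmodType R, free_module F & embeds M F.

Definition finitely_generated (M : lmodType R) : Prop :=
  exists s : seq M, forall x : M,
    exists c : M -> R, x = \sum_(v <- s) c v *: v.

(* M is the cokernel of some g : R^m -> R^n. *)
Definition finitely_presented (M : lmodType R) : Prop :=
  exists (m n : nat) (g : {linear 'rV[R]_m -> 'rV[R]_n})
         (f : {linear 'rV[R]_n -> M}),
    (forall y, exists x, f x = y) /\
    (forall x, f x = 0 <-> exists z, g z = x).

Definition cyclic_module (M : lmodType R) : Prop :=
  exists x : M, forall y : M, exists a : R, y = a *: x.

(* An ideal of R is a submodule of R^o; [boolp] makes every Prop-valued
   predicate boolean, so boolean membership is no restriction. *)
Definition ideal := submodClosed R^o.

End ModuleNotions.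

Section SubModule.
Variables (R : comPzRingType) (V : lmodType R) (U : submodClosed V).

Record submodule := Submodule { submodule_val : V; _ : submodule_val \in U }.

HB.instance Definition _ := [isSub for submodule_val].
HB.instance Definition _ := [Choice of submodule by <:].
HB.instance Definition _ := [SubChoice_isSubLmodule of submodule by <:].

End SubModule.

Section IdealNotions.
Variable R : comPzRingType.

Definition fg_ideal (I : ideal R) : Prop := finitely_generated (submodule I).

Definition coherent : Prop :=
  forall I : ideal R, fg_ideal I -> finitely_presented (submodule I).

Definition ideal_set (I : ideal R) : set R := [set x | x \in I]%classic.

(* (0 : I) *)
Definition ann (I : set R) : set R := [set r | forall x, I x -> r * x = 0]%classic.

End IdealNotions.

(* Main.v *)
Require Import Defs.
From HB Require Import structures.
From mathcomp Require Import all_boot all_order all_algebra.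
From mathcomp Require Import generic_quotient ring_quotient.
From mathcomp Require Import boolp classical_sets functions.

(** The theorem compares a statement about all modules with statements about
    finitely many generators, and both passages are made of finite systems of
    linear equations over [R], written below with matrices.

    If [R] is semiregular, finitely presented modules embed in free modules.
    When [F] is flat, finitely many relations [A x = 0] between elements of [F]
    are explained by relations in [R]: [x = D y] with [A D = 0] (lemma
    [flat_factors_relations]).  Apply this to the images in [F] of the
    generators of a finitely presented [M] that embeds in [F]: the embedding
    factors through some [R^p], so [M] embeds in [R^p].

    If cyclic finitely presented modules embed in free modules, then [R] is
    coherent and finitely generated ideals are double annihilators.  Embed [R/I]
    in a free module and let [d] be the finitely many coordinates of the image
    of [1]; then [I = (0 : d)].  Hence every finitely generated ideal is the
    annihilator of a finitely generated ideal ([annihilator_ideals]).  This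
    gives the double annihilator condition at once; it also makes the
    annihilators [(0 : J)] and the colon ideals [(I : r) = (0 : r d)] finitely
    generated, from which the finite generation
    of all syzygy modules follows by induction on the number of generators.

    If [R] is coherent and finitely generated ideals are double annihilators,
    then [R] is semiregular.  The two conditions together imply that a linear
    form on a finitely generated submodule of [R^m] extends to [R^m]
    ([extend_functional]).  Given a module [M], consider the functions
    [w : M -> R] that respect the linear structure of [M] on a given finite set
    of triples, [w (a x + y) = a w(x) + w(y)].  As the finite set grows, these
    sets of functions [w] form a filter base on [M -> R]; let [F] be the module
    of germs of functions [(M -> R) -> R] along this filter, that is, a reduced
    power of [R].
    - [M] embeds in [F] by evaluation.  If [w x = 0] for all [w] linear on some
      finite set, then extension of linear forms writes [x = 0] as a
      consequence of finitely many relations that hold in [M].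
    - [F] is flat.  A relation in [F] holds pointwise on a set of the filter.
      Coherence solves it pointwise with coefficients that do not depend on the
      point, so relations in [F] factor as above; and a module whose relations
      factor is flat ([factors_relations_flat]).

    The functions that are linear on a finite set also serve in that last step:
    a vanishing tensor [sum x_i (x) b_i] is killed by every [w] that is linear
    on a suitable finite set, because a derivation of its vanishing uses only
    finitely many instances of linearity in the first factor
    ([tens_eq_linear_on]). *)

Set Implicit Arguments.
Unset Strict Implicit.
Unset Printing Implicit Defensive.

Import GRing.Theory.

Local Open Scope quotient_scope.
Local Open Scope ring_scope.

(** * Extension of linear forms over a coherent ring with double annihilators *)

Section Matrices.
Variable R : comPzRingType.

(** For a column [G], the condition [row_span G x%:M] says that the scalar [x]
    lies in the ideal generated by the entries of [G]. *)
Definition row_span m n (G : 'M[R]_(m, n)) (u : 'rV[R]_n) : Prop :=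
  exists z : 'rV[R]_m, u = z *m G.

(** Coherence, in terms of a chosen finite family of generators. *)
Definition fg_syzygies : Prop :=
  forall n (c : 'cV[R]_n), exists m (G : 'M[R]_(m, n)),
    forall u : 'rV[R]_n, u *m c = 0 <-> row_span G u.

(** For the ideal [I] generated by the entries of [c], this is the inclusion of
    [(0 : (0 : I))] in [I], the one of the two that is not automatic. *)
Definition double_ann : Prop :=
  forall n (c : 'cV[R]_n) (x : R),
    (forall r, r *: c = 0 -> r * x = 0) -> row_span c x%:M.

Lemma gens_mulmx0 n p m (c : 'M[R]_(n, p)) (G : 'M[R]_(m, n)) :
  (forall u : 'rV[R]_n, u *m c = 0 <-> row_span G u) -> G *m c = 0.
Proof.
move=> GP; apply/row_matrixP => i; rewrite row_mul row0; apply/GP.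
by exists (delta_mx 0 i); rewrite rowE.
Qed.

Lemma scalar_mx1_inj : injective (@scalar_mx R 1).
Proof. by move=> x y /matrixP/(_ 0 0); rewrite !mxE eqxx !mulr1n. Qed.

(** Coherence passes from ideals to submodules of [R^p], one column at a time:
    the syzygies of [a] are the rows of some [G], and those that also kill [A']
    correspond to the syzygies of [G A']. *)
Lemma fg_syzygies_mx : fg_syzygies ->
  forall n p (A : 'M[R]_(n, p)), exists m (G : 'M[R]_(m, n)),
    forall u : 'rV[R]_n, u *m A = 0 <-> row_span G u.
Proof.
move=> syz n p; elim: p n => [|p IHp] n A.
  exists n, 1%:M => u; split=> _; last exact: thinmx0.
  by exists u; rewrite mulmx1.
pose a := lsubmx (A : 'M_(n, 1 + p)); pose A' := rsubmx (A : 'M_(n, 1 + p)).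
have uA u : u *m A = row_mx (u *m a) (u *m A') by rewrite -mul_mx_row hsubmxK.
have [m [G GP]] := syz n a.
have [q [H HP]] := IHp m (G *m A').
exists q, (H *m G) => u; rewrite uA; split=> [|[z ->]].
  rewrite -(@row_mx0 _ _ 1 p) => /(@eq_row_mx _ _ 1 p) [/GP [z ->]].
  by rewrite -mulmxA => /HP[t ->]; exists t; rewrite mulmxA.
have G0 : row_span G (z *m (H *m G)) by exists (z *m H); rewrite mulmxA.
have /HP H0 : row_span H (z *m H) by exists z.
by rewrite (GP _).2 // -!mulmxA mulmxA H0 row_mx0.
Qed.

(** A linear form on the ideal generated by the entries of [b], with values [v]
    on these generators, is the multiplication by an element of [R].  By
    induction the form may be taken to vanish on the ideal [I'] of the last
    entries and to have the value [w] at the first entry [beta].  Then [w] is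
    killed by the colon ideal [(I' : beta)], which is [(0 : beta (0 : I'))]
    since [I'] is its own double annihilator; as [(0 : I')] is finitely
    generated, [w] lies in [beta (0 : I')]. *)
Lemma extend_functional_ideal :
  fg_syzygies -> double_ann -> forall n (b v : 'cV[R]_n),
  (forall u : 'rV[R]_n, u *m b = 0 -> u *m v = 0) -> exists x : R, v = x *: b.
Proof.
move=> syz dann; elim=> [|n IHn] b v bv.
  by exists 0; rewrite [v]flatmx0 [b]flatmx0 scaler0.
pose b0 := usubmx (b : 'M_(1 + n, 1)); pose b' := dsubmx (b : 'M_(1 + n, 1)).
pose v0 := usubmx (v : 'M_(1 + n, 1)); pose v' := dsubmx (v : 'M_(1 + n, 1)).
have mulb t u : @row_mx _ 1 1 n t u *m b = t *m b0 + u *m b'.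
  by rewrite -(@mul_row_col _ _ 1 n) vsubmxK.
have mulv t u : @row_mx _ 1 1 n t u *m v = t *m v0 + u *m v'.
  by rewrite -(@mul_row_col _ _ 1 n) vsubmxK.
have [u u'b'|x0 v'E] := IHn b' v'.
  have := bv (@row_mx _ 1 1 n 0 u); rewrite mulb mulv !mul0mx !add0r.
  exact.
have [beta b0E] : exists r, b0 = r%:M by exists (b0 0 0); exact: mx11_scalar.
have [omega v0E] : exists r, v0 = r%:M by exists (v0 0 0); exact: mx11_scalar.
pose w := omega - x0 * beta.
(* The entries of [G] generate [(0 : I')]. *)
have [q [G GP]] := fg_syzygies_mx syz b'^T.
have [r rG|z] := @dann q (beta *: G) w.
  have [t tb'|u uE] := @dann n b' (r * beta).
    have [z zE] : row_span G t%:M.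
      by apply/GP; rewrite mul_scalar_mx -linearZ tb' linear0.
    have : ((r * beta) *: z *m G) = 0.
      by rewrite -scalemxAl scalemxAr -scalerA rG mulmx0.
    rewrite -scalemxAl -zE => /matrixP/(_ 0 0); rewrite !mxE eqxx mulr1n.
    by rewrite mulrC.
  have := bv (@row_mx _ 1 1 n r%:M (- u)); rewrite mulb mulv !mulNmx -uE.
  rewrite b0E -scalar_mxM subrr => /(_ erefl).
  rewrite v'E -scalemxAr -uE => /matrixP/(_ 0 0).
  rewrite v0E -scalar_mxM !mxE eqxx !mulr1n => e.
  by rewrite /w mulrBr mulrCA.
have [s sE] : exists s, z *m G = s%:M.
  by exists ((z *m G) 0 0); exact: mx11_scalar.
rewrite -scalemxAr sE scale_scalar_mx => /scalar_mx1_inj wE.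
have sb' : s *: b' = 0.
  have /GP : row_span G s%:M by exists z.
  by rewrite mul_scalar_mx -linearZ /= => /eqP; rewrite trmx_eq0 => /eqP.
exists (x0 + s); rewrite -[v](@vsubmxK _ 1 n) -[b](@vsubmxK _ 1 n).
rewrite (@scale_col_mx _ 1 n); congr (@col_mx _ 1 n 1 _ _).
  rewrite -/b0 -/v0 b0E v0E scale_scalar_mx; congr _%:M.
  by rewrite mulrDl [s * beta]mulrC -wE /w addrC subrK.
by rewrite scalerDl sb' addr0.
Qed.

(** A linear form, with values [v], on the submodule generated by the rows of
    [B] extends to [R^m].  The vectors of the submodule whose first coordinate
    is zero are generated by the rows of [G B], by coherence; the form extends
    there by induction.  What remains of it depends only on the first
    coordinate, hence is a form on an ideal. *)
Lemma extend_functional :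
  fg_syzygies -> double_ann -> forall n m (B : 'M[R]_(n, m)) (v : 'cV[R]_n),
  (forall u : 'rV[R]_n, u *m B = 0 -> u *m v = 0) ->
  exists x : 'cV[R]_m, v = B *m x.
Proof.
move=> syz dann n m; elim: m n => [|m IHm] n B v Bv.
  exists 0; rewrite mulmx0; apply/row_matrixP => i.
  by rewrite rowE row0 Bv // thinmx0.
pose b := lsubmx (B : 'M_(n, 1 + m)); pose B' := rsubmx (B : 'M_(n, 1 + m)).
have mulB k (u : 'M_(k, n)) : u *m B = row_mx (u *m b) (u *m B').
  by rewrite -mul_mx_row hsubmxK.
have [k [G GP]] := syz n b.
have Gb := gens_mulmx0 GP.
have [u uGB'|x' Gv] := IHm k (G *m B') (G *m v).
  by rewrite mulmxA Bv // mulB -!mulmxA Gb mulmx0 uGB' row_mx0.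
have [u /GP[z ->]|x0 vE] :=
  @extend_functional_ideal syz dann n b (v - B' *m x').
  by rewrite -mulmxA mulmxBr Gv mulmxA subrr mulmx0.
exists (@col_mx _ 1 m 1 x0%:M x'); rewrite -[B](@hsubmxK _ n 1 m).
rewrite (@mul_row_col _ n 1 m) mul_mx_scalar -vE.
by rewrite subrK.
Qed.
End Matrices.

(** * Rings whose finitely generated ideals are annihilators *)

Section AnnihilatorIdeals.
Variable R : comPzRingType.

Definition annihilator_ideals : Prop :=
  forall n (c : 'cV[R]_n), exists k (d : 'cV[R]_k),
    forall x : R, row_span c x%:M <-> x *: d = 0.

Lemma row_span_entry n (c : 'cV[R]_n) i : row_span c (c i 0)%:M.
Proof.
exists (delta_mx 0 i); apply/matrixP => j k.
by rewrite -rowE !ord1 !mxE eqxx.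
Qed.

Lemma scale_col_eq0 n (c : 'cV[R]_n) r :
  r *: c = 0 <-> forall i, r * c i 0 = 0.
Proof.
split=> [/matrixP rc i|rc]; first by have := rc i 0; rewrite !mxE.
by apply/matrixP => i j; rewrite !mxE ord1.
Qed.

(** If [I = (0 : d)], the entries of [d] annihilate [I], so whatever is killed
    by [(0 : I)] is killed by [d]. *)
Lemma annihilator_ideals_double_ann : annihilator_ideals -> double_ann R.
Proof.
move=> annI n c x xc; have [k [d dP]] := annI n c.
apply/dP/scale_col_eq0 => j; rewrite mulrC.
apply: xc; apply/scale_col_eq0 => i; rewrite mulrC.
by move: j; apply/scale_col_eq0/dP; exact: row_span_entry.
Qed.

(** If [(c) = (0 : d)] and [(d) = (0 : d')], then [(0 : c)] is the double
    annihilator of [(d)], which is [(d)] itself. *)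
Lemma annihilator_fg : annihilator_ideals ->
  forall n (c : 'cV[R]_n), exists q (e : 'cV[R]_q),
    forall r : R, r *: c = 0 <-> row_span e r%:M.
Proof.
move=> annI n c; have [k [d dP]] := annI n c.
have [l [d' d'P]] := annI k d.
exists k, d => r; rewrite d'P; split=> [rc|/d'P[z zE]].
  apply/scale_col_eq0 => j.
  have /dP[z zE] : d' j 0 *: d = 0.
    apply/scale_col_eq0 => i; rewrite mulrC.
    by move: j; apply/scale_col_eq0/d'P; exact: row_span_entry.
  have : r *: (d' j 0)%:M = 0 :> 'M_1 by rewrite zE scalemxAr rc mulmx0.
  by rewrite scale_scalar_mx -(raddf0 (@scalar_mx R 1)) => /scalar_mx1_inj.
apply/scale_col_eq0 => i; rewrite mulrC.
have /dP cd := row_span_entry c i.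
have : c i 0 *: r%:M = 0 :> 'M_1 by rewrite zE scalemxAr cd mulmx0.
by rewrite scale_scalar_mx -(raddf0 (@scalar_mx R 1)) => /scalar_mx1_inj.
Qed.

(** Induction on the number of generators.  With [I'] the ideal of the last
    entries [c'] of [c] and [beta] the first one, the first coordinates of the
    syzygies of [c] form the colon ideal [(I' : beta) = (0 : beta d)], where
    [I' = (0 : d)]; it is generated by the entries of some [e].  Lifting these
    to syzygies of [c], and adding the syzygies of [c'], gives generators. *)
Lemma annihilator_ideals_fg_syzygies : annihilator_ideals -> fg_syzygies R.
Proof.
move=> annI; elim=> [|n IHn] c.
  exists 0, 0 => u; split=> _; first by exists 0; rewrite !thinmx0.
  by rewrite thinmx0 mul0mx.
pose c' := dsubmx (c : 'M_(1 + n, 1)).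
have mulc k t (u : 'M_(k, n)) : @row_mx _ k 1 n t u *m c = c 0 0 *: t + u *m c'.
  rewrite -mul_mx_scalar -[X in X%:M](_ : usubmx (c : 'M_(1 + n, 1)) 0 0 = _).
    by rewrite -mx11_scalar -(@mul_row_col _ _ 1 n) vsubmxK.
  by rewrite mxE; congr (c _ _); apply: val_inj.
have [m [G GP]] := IHn c'; have [k [d dP]] := annI n c'.
have [q [e eP]] := annihilator_fg annI (c 0 0 *: d).
have /choice[U UP] j : exists u : 'rV_n, (c 0 0 * e j 0)%:M = u *m c'.
  apply/dP; rewrite mulrC -scalerA; apply/eP; exact: row_span_entry.
pose UU := \matrix_j U j.
have UUc : UU *m c' = c 0 0 *: e.
  apply/row_matrixP => j; rewrite row_mul rowK -UP.
  by apply/matrixP=> a b; rewrite !ord1 !mxE eqxx mulr1n.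
have Gc := gens_mulmx0 GP.
exists (q + m), (col_mx (@row_mx _ q 1 n e (- UU)) (@row_mx _ m 1 n 0 G)) => u.
split=> [|[z ->]]; last first.
  rewrite -mulmxA mul_col_mx !mulc mulNmx UUc subrr Gc scaler0 addr0.
  by rewrite col_mx0 mulmx0.
rewrite -[u](@hsubmxK _ 1 1 n).
move: (@lsubmx _ _ 1 n u) (@rsubmx _ _ 1 n u) => t {}u; rewrite mulc.
have [r ->] : exists r, t = r%:M by exists (t 0 0); exact: mx11_scalar.
rewrite scale_scalar_mx => ru.
have [z zE] : row_span e r%:M.
  apply/eP; rewrite scalerA mulrC; apply/dP; exists (- u).
  by rewrite mulNmx; apply/eqP; rewrite -addr_eq0 ru.
have /GP[z' z'E] : (u + z *m UU) *m c' = 0.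
  rewrite mulmxDl -mulmxA UUc -scalemxAr -zE scale_scalar_mx addrC; exact: ru.
exists (row_mx z z').
rewrite mul_row_col !(@mul_mx_row _ _ _ 1 n) mulmx0 mulmxN.
rewrite (@add_row_mx _ 1 1 n) addr0 -zE -z'E.
by rewrite addrCA addNr addr0.
Qed.

(** Whether the syzygies are finitely generated depends only on the module and
    not on its generators: a syzygy [u] of [c] is [u (1 - Q P) + (u Q) P], where
    the rows of [1 - Q P] are syzygies of [c] and [u Q] is a syzygy of [b]. *)
Lemma syzygies_change_gens n p (c : 'cV[R]_n) (b : 'cV[R]_p) P Q m
    (G : 'M[R]_(m, p)) :
  P *m c = b -> Q *m b = c ->
  (forall u : 'rV[R]_p, u *m b = 0 <-> row_span G u) ->
  exists m' (H : 'M[R]_(m', n)),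
    forall u : 'rV[R]_n, u *m c = 0 <-> row_span H u.
Proof.
move=> Pc Qb GP; exists (n + m), (col_mx (1%:M - Q *m P) (G *m P)) => u.
have Gb := gens_mulmx0 GP.
split=> [uc|[z ->]].
  have /GP[z zE] : (u *m Q) *m b = 0 by rewrite -mulmxA Qb.
  exists (row_mx u z); rewrite mul_row_col mulmxA -zE mulmxBr mulmx1 mulmxA.
  by rewrite subrK.
rewrite -mulmxA mul_col_mx mulmxBl mul1mx -!mulmxA Pc Qb subrr Gb.
by rewrite col_mx0 mulmx0.
Qed.

End AnnihilatorIdeals.

(** * Finitely generated ideals as columns *)

Section FinitelyGenerated.
Variable R : comPzRingType.

Lemma linear_map (U V : lmodType R) (f : U -> V) :
  linear f -> exists g : {linear U -> V}, g =1 f.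
Proof.
move=> lf.
pose mf := GRing.isLinear.Build R U V *:%R f lf.
by exists (HB.pack f mf : {linear U -> V}).
Qed.

(** Coefficients indexed by vectors and coefficients indexed by positions give
    the same notion: when a vector occurs at several positions, its
    coefficients add up. *)
Lemma finitely_generatedP (M : lmodType R) :
  finitely_generated M <->
  exists n (e : 'I_n -> M), forall x, exists u : 'I_n -> R,
    x = \sum_i u i *: e i.
Proof.
split=> [[s sP]|[n [e eP]]].
  exists (size s), (tnth (in_tuple s)) => x; have [c ->] := sP x.
  by exists (fun i => c (tnth (in_tuple s) i)); rewrite big_tnth.
exists (undup (codom e)) => x; have [u ->] := eP x.
exists (fun v => \sum_(i | e i == v) u i).
rewrite (eq_bigr (fun v => \sum_(i | e i == v) u i *: e i)); last first.
  by move=> v _; rewrite scaler_suml; apply: eq_bigr => i /eqP->.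
rewrite (exchange_big_dep predT) //=; apply: eq_bigr => i _.
rewrite -big_filter (_ : filter _ _ = [:: e i]) ?big_seq1 //.
rewrite -(eq_filter (a1 := pred1 (e i))) => [|v]; last exact: eq_sym.
by rewrite filter_pred1_uniq ?undup_uniq // mem_undup codom_f.
Qed.

Lemma submodule_val_sum (V : lmodType R) (U : submodClosed V) n
    (e : 'I_n -> submodule U) (u : 'I_n -> R) :
  val (\sum_i u i *: e i) = \sum_i u i *: val (e i).
Proof. by elim/big_ind2: _ => // x a y b <- <-. Qed.

Lemma ideal_has_gens (I : ideal R) : fg_ideal I ->
  exists n (c : 'cV[R]_n), forall x : R, (x : R^o) \in I <-> row_span c x%:M.
Proof.
move=> /finitely_generatedP[n [e eP]]; exists n, (\col_i val (e i)) => x.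
split=> [xI|[u xu]].
  have [u uE] := eP (Submodule xI); exists (\row_i u i).
  rewrite [RHS]mx11_scalar; congr _%:M.
  rewrite (_ : x = val (Submodule xI)) // uE submodule_val_sum mxE.
  by apply: eq_bigr => i _; rewrite !mxE.
have -> : (x : R^o) = \sum_i u 0 i *: val (e i).
  move/matrixP/(_ 0 0): xu; rewrite !mxE eqxx mulr1n => ->.
  by apply: eq_bigr => i _; rewrite mxE.
by apply: rpred_sum => i _; apply: rpredZ; exact: valP.
Qed.

Lemma submod_of_pred (V : lmodType R) (P : V -> Prop) :
  P 0 -> (forall a x y, P x -> P y -> P (a *: x + y)) ->
  exists U : submodClosed V, forall x, x \in U <-> P x.
Proof.
move=> P0 Plin; pose S : {pred V} := fun x => `[< P x >].
have SP : submod_closed S.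
  split; first exact/asboolP.
  by move=> a x y /asboolP Px /asboolP Py; apply/asboolP/Plin.
exists (HB.pack S (GRing.isSubmodClosed.Build R V S SP) : submodClosed V) => x.
by split=> /asboolP.
Qed.

Lemma span_ideal n (c : 'cV[R]_n) :
  exists2 I : ideal R, fg_ideal I &
    forall x : R, (x : R^o) \in I <-> row_span c x%:M.
Proof.
have [||I IP] := @submod_of_pred R^o (fun x => row_span c (x : R)%:M).
- by exists 0; rewrite mul0mx raddf0.
- move=> a x y [u xu] [v yv]; exists (a *: u + v).
  by rewrite mulmxDl -scalemxAl -xu -yv scale_scalar_mx raddfD.
exists I => //; apply/finitely_generatedP.
have cI i : (c i 0 : R^o) \in I by apply/IP; exact: row_span_entry.
exists n, (fun i => Submodule (cI i)) => x.
have /IP[u uE] := valP x; exists (u 0); apply: val_inj.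
rewrite submodule_val_sum; move/matrixP/(_ 0 0): uE.
by rewrite !mxE eqxx mulr1n => ->.
Qed.

(** A finite presentation of the ideal comes with its own generators [b]; the
    syzygies are carried over to the given generators [c]. *)
Lemma coherent_fg_syzygies : coherent R -> fg_syzygies R.
Proof.
move=> coh n c; have [I Ifg IP] := span_ideal c.
have [m [p [g [f [fsurj fker]]]]] := coh I Ifg.
pose b : 'cV_p := \col_i val (f (delta_mx 0 i)).
have fE u : (val (f u) : R)%:M = u *m b.
  rewrite [RHS]mx11_scalar; congr _%:M.
  rewrite {1}[u]row_sum_delta linear_sum.
  under eq_bigr do rewrite linearZ_LR.
  by rewrite submodule_val_sum mxE; apply: eq_bigr => i _; rewrite mxE.
have /choice[P PE] i : exists u : 'rV_n, (b i 0)%:M = u *m c.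
  by apply/IP; rewrite mxE; exact: valP.
have /choice[Q QE] j : exists u : 'rV_p, (c j 0)%:M = u *m b.
  have cI : (c j 0 : R^o) \in I by apply/IP; exact: row_span_entry.
  by have [u uE] := fsurj (Submodule cI); exists u; rewrite -fE uE.
apply: (@syzygies_change_gens _ n p c b (\matrix_i P i) (\matrix_i Q i) m
          (lin1_mx g)).
- apply/row_matrixP => i; rewrite row_mul rowK -PE.
  by apply/matrixP => a k; rewrite !ord1 !mxE eqxx mulr1n.
- apply/row_matrixP => i; rewrite row_mul rowK -QE.
  by apply/matrixP => a k; rewrite !ord1 !mxE eqxx mulr1n.
move=> u; split=> [ub|[z ->]].
  have /fker[z <-] : f u = 0.
    apply: val_inj; have := fE u; rewrite ub => /matrixP/(_ 0 0).
    by rewrite !mxE eqxx mulr1n.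
  by exists z; rewrite mul_rV_lin1.
rewrite mul_rV_lin1 -fE (fker _).2 ?raddf0 //; last by exists z.
Qed.

Lemma fg_syzygies_coherent : fg_syzygies R -> coherent R.
Proof.
move=> syz I /ideal_has_gens[n [c cP]]; have [m [G GP]] := syz n c.
have uI (u : 'rV_n) : ((u *m c) 0 0 : R^o) \in I.
  by apply/cP; exists u; rewrite -mx11_scalar.
have [|f fE] := @linear_map 'rV_n (submodule I) (fun u => Submodule (uI u)).
  move=> a u v; apply: val_inj => /=.
  by rewrite mulmxDl -scalemxAl !mxE.
exists m, n, (mulmxr G), f; split=> [y|u].
  have /cP[u uE] := valP y; exists u; rewrite fE; apply: val_inj => /=.
  by rewrite -uE mxE eqxx mulr1n.
rewrite fE; split=> [/(congr1 val)/= uc|[z <-]].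
  have /GP[z ->] : u *m c = 0 by rewrite [LHS]mx11_scalar uc raddf0.
  by exists z.
apply: val_inj => /=; rewrite (GP _).2 ?mxE //; by exists z.
Qed.

Lemma double_annP : double_ann R <->
  forall I : ideal R, fg_ideal I -> ann (ann (ideal_set I)) = ideal_set I.
Proof.
split=> [dann I /ideal_has_gens[n [c cP]]|dann n c x xc].
  apply/seteqP; split=> x /= xI; last by move=> r rI; rewrite mulrC rI.
  apply/cP/dann => r /scale_col_eq0 rc; rewrite mulrC; apply: xI => y /cP[u yu].
  have : r *: y%:M = 0 :> 'M_1.
    by rewrite yu scalemxAr (scale_col_eq0 c r).2 ?mulmx0.
  by rewrite scale_scalar_mx -(raddf0 (@scalar_mx R 1)) => /scalar_mx1_inj.
have [I Ifg IP] := span_ideal c.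
apply/IP; have /seteqP[+ _] := dann I Ifg; apply=> r rI.
rewrite mulrC; apply: xc; apply/scale_col_eq0 => i; apply: rI.
by apply/IP; exact: row_span_entry.
Qed.

End FinitelyGenerated.

(** * Quotient modules and free modules *)

Section QuotientModule.
Variables (R : comPzRingType) (V : lmodType R) (U : submodClosed V).

(** A submodule seen as a subgroup: the quotient is that of the additive groups,
    with the scaling added. *)
Definition submod_pred : {pred V} := fun x => x \in U.

Lemma submod_pred_zmod : zmod_closed submod_pred.
Proof. exact: GRing.submod_closedB (submodClosedP U). Qed.

HB.instance Definition _ :=
  GRing.isZmodClosed.Build V submod_pred submod_pred_zmod.

Definition quotmod := Quotient.quot submod_pred.
HB.instance Definition _ := GRing.Zmodule.on quotmod.

Definition qpi (x : V) : quotmod := \pi_(Quotient.quot submod_pred) x.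

Lemma qpi_eq x y : qpi x = qpi y <-> x - y \in U.
Proof.
split=> [/eqP|xy]; first by rewrite -Quotient.idealrBE.
by apply/eqP; rewrite -Quotient.idealrBE.
Qed.

Lemma qpi_repr (x : quotmod) : qpi (repr x) = x.
Proof. exact: reprK. Qed.

Lemma qpiD x y : qpi (x + y) = qpi x + qpi y.
Proof. exact: Quotient.pi_add. Qed.

Definition qscale (a : R) (x : quotmod) : quotmod := qpi (a *: repr x).

Lemma qscaleE a x : qscale a (qpi x) = qpi (a *: x).
Proof. by apply/qpi_eq; rewrite -scalerBr rpredZ //; apply/qpi_eq/qpi_repr. Qed.

Lemma qscaleA a b x : qscale a (qscale b x) = qscale (a * b) x.
Proof. by rewrite -(qpi_repr x) !qscaleE scalerA. Qed.

Lemma qscale1 : left_id 1 qscale.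
Proof. by move=> x; rewrite -[x]qpi_repr qscaleE scale1r. Qed.

Lemma qscaleDr : right_distributive qscale +%R.
Proof.
move=> a x y; rewrite -[x]qpi_repr -[y]qpi_repr -qpiD !qscaleE scalerDr.
exact: qpiD.
Qed.

Lemma qscaleDl x : {morph qscale^~ x : a b / a + b}.
Proof.
by move=> a b; rewrite -[x]qpi_repr !qscaleE scalerDl; exact: qpiD.
Qed.

HB.instance Definition _ :=
  GRing.Zmodule_isLmodule.Build R quotmod qscaleA qscale1 qscaleDr qscaleDl.

Lemma quotient_module : exists (Q : lmodType R) (p : {linear V -> Q}),
  (forall y, exists x, p x = y) /\ (forall x, p x = 0 <-> x \in U).
Proof.
have [|p pE] := @linear_map R V quotmod qpi.
  by move=> a x y; rewrite qpiD -qscaleE.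
exists quotmod, p; split=> [y|x]; first by exists (repr y); rewrite pE qpi_repr.
have q0 : qpi 0 = 0 by rewrite -pE linear0.
by rewrite pE -q0; apply: (iff_trans (qpi_eq x 0)); rewrite subr0.
Qed.

End QuotientModule.

Section Free.
Variable R : comPzRingType.

(** Linear independence is stated for sequences without repetition, whereas
    a spanning combination may repeat vectors. *)
Lemma undup_comb (M : lmodType R) (s : seq M) (c : M -> R) :
  \sum_(v <- s) c v *: v = \sum_(v <- undup s) (c v *+ count_mem v s) *: v.
Proof.
rewrite -big_undup_iterop_count; apply: eq_bigr => v _.
exact: scalerMnl.
Qed.

Lemma row_space_free n : free_module 'rV[R]_n.
Proof.
exists [set v | exists i, v = delta_mx 0 i]%classic.
split=> [x|s c s_uniq sB s0 v vs].
  (* The coefficient is a function of the vector; the scalar product with [x]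
     has the right value at each unit vector, even when [R] is the zero ring
     and the unit vectors coincide. *)
  exists [seq delta_mx 0 i | i <- enum 'I_n].
  exists (fun v : 'rV[R]_n => \sum_i v 0 i * x 0 i).
  split=> [v /mapP[i _ ->]|]; first by exists i.
  rewrite big_map big_enum /= {1}[x]row_sum_delta; apply: eq_bigr => i _.
  congr (_ *: _); rewrite (bigD1 i) //= big1 ?addr0 ?mxE ?eqxx ?mul1r //.
  by move=> j ji; rewrite mxE eqxx (negPf ji) mul0r.
have [i vi] := sB v vs.
move/matrixP/(_ 0 i): s0; rewrite summxE (bigD1_seq v) //= big_seq_cond big1.
  by rewrite addr0 vi !mxE !eqxx mulr1.
move=> w /andP[/sB[j ->]]; rewrite vi !mxE eqxx /=.
by have [->|_ _] := eqVneq i j; rewrite ?eqxx ?mulr0.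
Qed.

(** An embedding of [R/I] in a free module maps the class of [1] to an element
    whose annihilator is [I]; this annihilator is that of its coordinates. *)
Lemma cyclic_embeds_annihilator_ideals :
  (forall M : lmodType R, finitely_presented M -> cyclic_module M ->
     embeds_in_free M) -> annihilator_ideals R.
Proof.
move=> emb n c; have [I _ IP] := span_ideal c.
have [Q [p [psurj pker]]] := quotient_module I.
have QE y : exists a : R, y = a *: p 1.
  have [x <-] := psurj y; exists x; rewrite -linearZ /=; congr (p _).
  by rewrite [RHS]mulr1.
have [||F [B [Bspan Bfree]] [h h_inj]] := emb Q.
- have [|f fE] := @linear_map R 'rV_1 Q (fun u => p (u 0 0)).
    by move=> a u v; rewrite !mxE linearP.
  exists n, 1%N, (mulmxr c), f; split=> [y|u].
    by have [x <-] := psurj y; exists x%:M; rewrite fE mxE eqxx mulr1n.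
  rewrite fE pker IP -mx11_scalar; split=> [[z ->]|[z <-]]; by exists z.
- by exists (p 1).
have [s [a [sB hE]]] := Bspan (h (p 1)).
rewrite undup_comb in hE.
exists (size (undup s)).
exists (\col_i (let v := tnth (in_tuple (undup s)) i in a v *+ count_mem v s)).
move=> x; rewrite -IP -pker.
have -> : p x = 0 <-> h (x *: p 1) = 0.
  have -> : x *: p 1 = p x by rewrite -linearZ /=; congr (p _); exact: mulr1.
  by split=> [->|]; [exact: raddf0|rewrite -(raddf0 h) => /h_inj].
rewrite linearZ_LR hE scaler_sumr scale_col_eq0.
under eq_bigr do rewrite scalerA.
split=> [x0 i|x0].
  rewrite mxE.
  apply: (Bfree (undup s) (fun v => x * (a v *+ count_mem v s))) => //.
  - exact: undup_uniq.
  - by move=> v; rewrite mem_undup; exact: sB.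
  - exact: mem_tnth.
rewrite big_tnth big1 // => i _; have := x0 i; rewrite mxE => ->.
by rewrite scale0r.
Qed.
End Free.

(** * Relations in flat modules *)

Section Flat.
Variable R : comPzRingType.

(** The equational criterion for flatness, for finite systems of relations. *)
Definition factors_relations (F : lmodType R) : Prop :=
  forall m n (A : 'M[R]_(m, n)) (x : 'I_n -> F),
    (forall k, \sum_i A k i *: x i = 0) ->
    exists p (D : 'M[R]_(n, p)) (y : 'I_p -> F),
      (forall i, x i = \sum_j D i j *: y j) /\ A *m D = 0.

Lemma pure0l (M N : lmodType R) (n : N) : pure (0 : M) n = 0.
Proof.
have [g gE] := linear_map (@pure_linearl R M N n).
by rewrite -gE linear0.
Qed.

Lemma pure_suml (M N : lmodType R) I (r : seq I) (a : I -> R) (m : I -> M)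
    (n : N) :
  pure (\sum_(i <- r) a i *: m i) n = \sum_(i <- r) a i *: pure (m i) n.
Proof.
have [g gE] := linear_map (@pure_linearl R M N n).
by rewrite -gE linear_sum; apply: eq_bigr => i _; rewrite linearZ_LR gE.
Qed.

Lemma pure_sumr (M N : lmodType R) I (r : seq I) (a : I -> R) (m : M)
    (n : I -> N) :
  pure m (\sum_(i <- r) a i *: n i) = \sum_(i <- r) a i *: pure m (n i).
Proof.
have [g gE] := linear_map (@pure_linearr R M N m).
by rewrite -gE linear_sum; apply: eq_bigr => i _; rewrite linearZ_LR gE.
Qed.

Lemma pure0r (M N : lmodType R) (m : M) : pure m (0 : N) = 0.
Proof.
have [g gE] := linear_map (@pure_linearr R M N m).
by rewrite -gE linear0.
Qed.

Lemma tensor_map_sum (M A B : lmodType R) (f : {linear A -> B}) I (r : seq I)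
    (m : I -> M) (a : I -> A) :
  tensor_map f (\sum_(i <- r) pure (m i) (a i)) =
  \sum_(i <- r) pure (m i) (f (a i)).
Proof.
have [g gE] := linear_map (@tensor_map_linear R M A B f).
by rewrite -gE linear_sum; apply: eq_bigr => i _; rewrite gE tensor_map_pure.
Qed.

(** Right exactness of the tensor product.  The case in mind is a section [v]
    of a surjection [R^n -> N] with kernel [K]: it is linear modulo [K].
    Lifting tensors along [v] gives elements of [M^n], the tensor product of
    [M] with [R^n], and equal tensors have lifts that differ by a sum of tensors with
    second factor in [K]: each rule of [tens_eq] contributes a defect of
    linearity of [v], or nothing. *)
Lemma tens_eq_section (M N : lmodType R) n (v : N -> 'rV[R]_n)
    (K : 'rV[R]_n -> Prop) :
  (forall x y, K (v (x + y) - (v x + v y))) ->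
  (forall a x, K (a *: v x - v (a *: x))) ->
  forall s t : seq (M * N), tens_eq s t ->
  exists l : seq (M * 'rV[R]_n), (forall p, p \in l -> K p.2) /\
    forall i, \sum_(p <- s) v p.2 0 i *: p.1 - \sum_(p <- t) v p.2 0 i *: p.1
            = \sum_(p <- l) p.2 0 i *: p.1.
Proof.
move=> vD vZ s t; elim=> {s t}.
- by move=> s; exists [::]; split=> // i; rewrite big_nil subrr.
- move=> s t _ [l [lK lE]]; exists [seq (- p.1, p.2) | p <- l]; split=> [p|i].
    by move=> /mapP[q /lK qK ->].
  rewrite big_map -opprB lE -sumrN; apply: eq_bigr => p _.
  by rewrite scalerN.
- move=> s t u _ [l [lK lE]] _ [l' [lK' lE']]; exists (l ++ l'); split=> [p|i].
    by rewrite mem_cat => /orP[/lK|/lK'].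
  by rewrite big_cat /= -lE -lE' addrA subrK.
- move=> s s' t t' _ [l [lK lE]] _ [l' [lK' lE']]; exists (l ++ l').
  split=> [p|i]; first by rewrite mem_cat => /orP[/lK|/lK'].
  by rewrite !big_cat /= -lE -lE' opprD addrACA.
- move=> s t; exists [::]; split=> // i; rewrite big_nil !big_cat /=.
  by rewrite [X in _ - X]addrC subrr.
- move=> y; exists [::]; split=> // i.
  by rewrite big_cons !big_nil scaler0 addr0 subr0.
- move=> m m' y; exists [::]; split=> // i.
  by rewrite !big_cons !big_nil scalerDr !addr0 subrr.
- move=> m y y'; exists [:: (m, v (y + y') - (v y + v y'))].
  split=> [p|i]; first by rewrite inE => /eqP->; exact: vD.
  by rewrite !big_cons !big_nil !addr0 /= !mxE scalerBl scalerDl.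
- move=> a m y; exists [:: (m, a *: v y - v (a *: y))].
  split=> [p|i]; first by rewrite inE => /eqP->; exact: vZ.
  rewrite !big_cons !big_nil !addr0 /= !mxE scalerBl scalerA.
  by rewrite [_ * a]mulrC.
Qed.

(** View [x] as the tensor [sum x_i (x) e_i] of [F] with [R^n].  Its image under
    the transpose of [A], a tensor of [F] with [R^m], vanishes by the relations;
    by flatness it already vanishes as a tensor of [F] with the image [N] of
    that map.  By right exactness [x] is then a sum of tensors [y_j (x) k_j]
    with [k_j] in the kernel of the transpose, and the [k_j] are the columns of
    [D]. *)
Lemma flat_factors_relations (F : lmodType R) : flat F -> factors_relations F.
Proof.
move=> Fflat m n A x Ax.
have [||N NP] := @submod_of_pred R 'rV_m (row_span A^T).
- by exists 0; rewrite mul0mx.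
- move=> a u v [z ->] [z' ->]; exists (a *: z + z').
  by rewrite mulmxDl scalemxAl.
have [|j jE] := @linear_map R (submodule N) 'rV_m val; first by [].
have j_inj : injective j by move=> a b; rewrite !jE => /val_inj.
have /choice[v vE] (w : submodule N) : exists z, val w = z *m A^T.
  by apply/NP; exact: valP.
pose d i : 'rV[R]_n := delta_mx 0 i.
have dN i : d i *m A^T \in N by apply/NP; exists (d i).
pose q i : submodule N := Submodule (dN i).
pose s := [seq (x i, q i) | i <- enum 'I_n].
have /tpiP s0 : tpi s = tpi [::].
  apply: (Fflat _ _ j j_inj); rewrite !tpi_sum !tensor_map_sum big_nil.
  rewrite big_map big_enum /=.
  have qE i : j (q i) = \sum_k A k i *: delta_mx 0 k.
    rewrite jE /= -rowE [LHS]row_sum_delta; apply: eq_bigr => k _.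
    by rewrite !mxE.
  under eq_bigr do rewrite qE pure_sumr.
  rewrite exchange_big big1 //= => k _; rewrite -pure_suml Ax.
  exact: pure0l.
pose K (u : 'rV[R]_n) := u *m A^T = 0.
have [|a w|l [lK lE]] := tens_eq_section (v := v) (K := K) _ _ s0.
- by move=> w w'; rewrite /K mulmxBl mulmxDl -!vE /= subrr.
- by rewrite /K mulmxBl -scalemxAl -!vE /= subrr.
(* The unit vector [d i] and the lift [v (q i)] have the same image, so their
   difference lies in the kernel and corrects the choice made by [v]. *)
pose l' := [seq (x i, d i - v (q i)) | i <- enum 'I_n] ++ l.
exists (size l'), (\matrix_(i, j) (tnth (in_tuple l') j).2 0 i).
exists (fun j => (tnth (in_tuple l') j).1); split=> [i|].
  under eq_bigr do rewrite mxE.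
  rewrite -(big_tnth _ _ l' xpredT (fun p => p.2 0 i *: p.1)) big_cat /= -lE.
  rewrite big_nil subr0 /s big_map big_enum big_map big_enum /= -big_split /=.
  rewrite (bigD1 i) //= big1 => [|k ki].
    by rewrite addr0 !mxE !eqxx -scalerDl subrK scale1r.
  by rewrite !mxE eq_sym (negPf ki) -scalerDl subrK scale0r.
apply/matrixP => k i; rewrite !mxE.
have : (tnth (in_tuple l') i).2 *m A^T = 0.
  have := mem_tnth i (in_tuple l').
  rewrite mem_cat => /orP[/mapP[h _ ->]|/lK //].
  by rewrite mulmxBl -vE subrr.
move/matrixP/(_ 0 k); rewrite !mxE => e; rewrite -[RHS]e; apply: eq_bigr => h _.
by rewrite !mxE mulrC.
Qed.

(** The relations of [M] hold between the images of its generators in [F]; the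
    matrix [D] that explains them there is a map on [M], through which the
    embedding in [F] factors. *)
Lemma factors_relations_embeds (M F : lmodType R) :
  factors_relations F -> embeds M F -> finitely_presented M ->
  exists p, embeds M 'rV[R]_p.
Proof.
move=> Ffac [iota iota_inj] [m [n [g [f [fsurj fker]]]]].
pose x i := iota (f (delta_mx 0 i)).
have xE (u : 'rV_n) : iota (f u) = \sum_i u 0 i *: x i.
  rewrite {1}[u]row_sum_delta !linear_sum; apply: eq_bigr => i _.
  by rewrite !linearZ_LR.
have [k|p [D [y [yE AD]]]] := Ffac m n (lin1_mx g) x.
  transitivity (iota (f (g (delta_mx 0 k)))).
    by rewrite xE; apply: eq_bigr => i _; rewrite !mxE.
  by rewrite (fker _).2 ?linear0 //; exists (delta_mx 0 k).
have iotaE u : iota (f u) = \sum_j (u *m D) 0 j *: y j.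
  rewrite xE; under eq_bigr do rewrite yE scaler_sumr.
  rewrite exchange_big; apply: eq_bigr => j _.
  by rewrite mxE scaler_suml; apply: eq_bigr => i _; rewrite scalerA.
have kerD u : f u = 0 -> u *m D = 0.
  by move=> /fker[z <-]; rewrite -mul_rV_lin1 -mulmxA AD mulmx0.
have /choice[sec secK] := fsurj.
have [|h hE] := @linear_map R M 'rV_p (fun z => sec z *m D).
  move=> a z z'; apply/eqP; rewrite scalemxAl -mulmxDl -subr_eq0 -mulmxBl.
  by rewrite kerD // linearB linearP !secK subrr.
exists p, h => z z'; rewrite !hE => zz'; apply: iota_inj.
by rewrite -(secK z) -(secK z') !iotaE zz'.
Qed.

End Flat.

(** * Germs of functions along almost linear forms *)

Section Germs.
Variable R : comPzRingType.

(** Functions on all of [M], linear only as far as the finitely many triples of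
    [L] can tell: they can separate the points of [M] even when [M] has no
    linear form other than [0]. *)
Definition linear_on (M : lmodType R) (L : seq (R * M * M)) (w : M -> R) :
    Prop :=
  forall a x y, (a, x, y) \in L -> w (a *: x + y) = a * w x + w y.

Lemma linear_on_cat (M : lmodType R) (L L' : seq (R * M * M)) w :
  linear_on (L ++ L') w -> linear_on L w /\ linear_on L' w.
Proof.
by move=> wL; split=> a x y axy; apply: wL; rewrite mem_cat axy ?orbT.
Qed.

(** Linearity on [L] is a finite system of linear equations [A u = 0], where [u]
    lists the values at the elements [e] involved in [L] and [s]; the same
    equations hold between these elements in [M].  The [e i] are distinct, so
    a solution [u] defines a function. *)
Lemma linear_on_matrix (M : lmodType R) (L : seq (R * M * M)) (s : seq M) :
  exists m n (A : 'M[R]_(m, n)) (e : 'I_n -> M),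
    [/\ forall k, \sum_i A k i *: e i = 0,
        forall x, x \in s -> exists i, e i = x
      & forall u : 'cV[R]_n, A *m u = 0 ->
          exists2 w, linear_on L w & forall i, w (e i) = u i 0].
Proof.
pose xs := undup (s ++ flatten
  [seq [:: r.1.1 *: r.1.2 + r.2; r.1.2; r.2] | r <- L]).
pose e i := tnth (in_tuple xs) i.
have eP x : x \in xs -> exists i, e i = x.
  by move=> /(tnthP (in_tuple xs))[i ->]; exists i.
have LP a x y : (a, x, y) \in L ->
    [/\ a *: x + y \in xs, x \in xs & y \in xs].
  move=> axy; have xsP z : z \in [:: a *: x + y; x; y] -> z \in xs.
    move=> zs; rewrite mem_undup mem_cat; apply/orP; right.
    apply/flattenP; exists [:: a *: x + y; x; y] => //.
    by apply/mapP; exists (a, x, y).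
  by split; apply: xsP; rewrite !inE eqxx ?orbT.
have e_inj i j : (e i == e j) = (i == j).
  by rewrite /e !(tnth_nth 0) nth_uniq ?undup_uniq.
have sum_e (N : lmodType R) x (h : 'I_(size xs) -> N) j :
    e j = x -> \sum_i (e i == x)%:R *: h i = h j.
  move=> <-; rewrite (bigD1 j) //= eqxx scale1r big1 ?addr0 // => i ij.
  by rewrite e_inj (negPf ij) scale0r.
pose A := \matrix_(k < size L, i < size xs)
  (let r := tnth (in_tuple L) k in
   (e i == r.1.1 *: r.1.2 + r.2)%:R
     - (r.1.1 * (e i == r.1.2)%:R + (e i == r.2)%:R) : R).
have AE (N : lmodType R) (h : 'I_(size xs) -> N) k :
    let r := tnth (in_tuple L) k in
    forall i0 i1 i2,
      e i0 = r.1.1 *: r.1.2 + r.2 -> e i1 = r.1.2 -> e i2 = r.2 ->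
    \sum_i A k i *: h i = h i0 - (r.1.1 *: h i1 + h i2).
  move=> r i0 i1 i2 e0 e1 e2.
  rewrite -(sum_e _ _ _ _ e0) -(sum_e _ _ _ _ e1) -(sum_e _ _ _ _ e2).
  rewrite scaler_sumr -big_split -sumrB; apply: eq_bigr => i _ /=.
  by rewrite mxE /= scalerBl scalerDl scalerA.
exists (size L), (size xs), A, e; split=> [k|x xs_x|u Au].
- have := mem_tnth k (in_tuple L).
  case: (tnth _ k) (AE M e k) => -[a x] y /= AEk axy.
  have [/eP[i0 e0] /eP[i1 e1] /eP[i2 e2]] := LP _ _ _ axy.
  by rewrite (AEk i0 i1 i2) // e0 e1 e2 subrr.
- by apply: eP; rewrite mem_undup mem_cat xs_x.
pose w x := \sum_i (e i == x)%:R * u i 0.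
have wE i : w (e i) = u i 0 by exact: (@sum_e R^o _ (fun i => u i 0)).
exists w => // a x y axy.
have [/eP[i0 e0] /eP[i1 e1] /eP[i2 e2]] := LP _ _ _ axy.
have /(tnthP (in_tuple L))[k kE] := axy.
have := AE R^o (fun i => u i 0) k i0 i1 i2; rewrite -kE /= => /(_ e0 e1 e2).
rewrite -e0 -e1 -e2 !wE => /esym/eqP.
have -> : \sum_i A k i *: (u i 0 : R^o) = 0.
  by move/matrixP/(_ k 0): Au; rewrite [X in X = _]mxE mxE.
by rewrite subr_eq0 => /eqP.
Qed.

(** Pairing the first factors with [w] respects all rules of [tens_eq] if [w] is
    linear; a given derivation of [tens_eq s t] needs this linearity only at
    the finitely many places where it uses the first factor. *)
Lemma tens_eq_linear_on (F B : lmodType R) (s t : seq (F * B)) : tens_eq s t ->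
  exists L, forall w, linear_on L w ->
    \sum_(p <- s) w p.1 *: p.2 = \sum_(p <- t) w p.1 *: p.2.
Proof.
(* Linearity at [(-1, 0, 0)] forces [w 0 = - w 0 + w 0 = 0]. *)
have w0 (L : seq (R * F * F)) w : linear_on ((-1, 0, 0) :: L) w -> w 0 = 0.
  move=> /(_ _ _ _ (mem_head _ _)).
  by rewrite scaler0 addr0 mulN1r addNr.
elim=> {s t}.
- by move=> s; exists [::].
- by move=> s t _ [L LP]; exists L => w /LP->.
- move=> s t u _ [L LP] _ [L' LP']; exists (L ++ L') => w.
  by case/linear_on_cat=> /LP-> /LP'->.
- move=> s s' t t' _ [L LP] _ [L' LP']; exists (L ++ L') => w.
  by case/linear_on_cat=> wL wL'; rewrite !big_cat /= LP // LP'.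
- by move=> s t; exists [::] => w _; rewrite !big_cat /= addrC.
- move=> y; exists [:: (-1, 0, 0)] => w /w0 w00.
  by rewrite big_cons !big_nil /= w00 scale0r addr0.
- move=> m m' y; exists [:: (1, m, m')] => w /(_ _ _ _ (mem_head _ _)).
  by rewrite scale1r mul1r !big_cons !big_nil !addr0 /= => ->; rewrite scalerDl.
- move=> m y y'; exists [::] => w _.
  by rewrite !big_cons !big_nil !addr0 scalerDr.
- move=> a m y; exists [:: (-1, 0, 0); (a, m, 0)] => w wL.
  have := wL a m 0; rewrite !inE eqxx orbT => /(_ isT).
  rewrite (w0 _ _ wL) !addr0 !big_cons !big_nil !addr0 /= => ->.
  by rewrite scalerA mulrC.
Qed.

(** If [sum x_i (x) f a_i = 0], then [sum w(x_i) f a_i = 0] for all [w] linear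
    on some finite [L].  Factoring the relations of [L] in [F] writes the [x_i]
    as [sum_j w_j(x_i) y_j] with such [w_j]; hence [sum_i x_i (x) a_i] is
    [sum_j y_j (x) (sum_i w_j(x_i) a_i)], and [f] being injective the second
    factors vanish. *)
Lemma factors_relations_flat (F : lmodType R) : factors_relations F -> flat F.
Proof.
move=> Ffac A B f f_inj z z' zz'.
have [g gE] := linear_map (@tensor_map_linear R F A B f).
apply/eqP; rewrite -subr_eq0; apply/eqP.
have : tensor_map f (z - z') = 0 by rewrite -gE linearB !gE zz' subrr.
move: (z - z') => {zz' z'} {}z; rewrite -(tpiK z); move: (repr z) => {z} s.
rewrite tpi_sum tensor_map_sum => s0.
have /tpiP/tens_eq_linear_on[L LP] :
    tpi [seq (p.1, f p.2) | p <- s] = tpi [::].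
  by rewrite !tpi_sum big_map big_nil.
have [m [n [C [e [Ce es ew]]]]] := linear_on_matrix L [seq p.1 | p <- s].
have [p [D [y [eE CD]]]] := Ffac m n C e Ce.
have /choice[w wP] j :
    exists w : F -> R, linear_on L w /\ forall i, w (e i) = D i j.
  have [|w wL we] := ew (col j D); last first.
    by exists w; split=> // i; rewrite we mxE.
  by rewrite colE mulmxA CD mul0mx.
have sw j : \sum_(q <- s) w j q.1 *: q.2 = 0.
  apply: f_inj; rewrite linear0 linear_sum.
  have := LP (w j) (wP j).1; rewrite big_map big_nil /= => e0.
  by rewrite -[RHS]e0; apply: eq_bigr => q _; rewrite linearZ_LR.
transitivity (\sum_(q <- s) \sum_j w j q.1 *: pure (y j) q.2).
  rewrite big_seq [RHS]big_seq; apply: eq_bigr => q qs.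
  have [i qE] := es q.1 (map_f _ qs).
  rewrite -pure_suml -qE {1}eE; congr pure.
  by apply: eq_bigr => j _; rewrite (wP j).2.
rewrite exchange_big big1 //= => j _.
by rewrite -pure_sumr sw pure0r.
Qed.

(** In the notation of [linear_on_matrix], [x = e i] and the [i]-th coordinate
    vanishes on the solutions of [A u = 0].  As linear forms extend, the
    coordinate form is then a combination of the rows of [A], so that [x = 0]
    follows from the relations between the [e i]. *)
Lemma linear_on_separates :
  fg_syzygies R -> double_ann R ->
  forall (M : lmodType R) (L : seq (R * M * M)) (x : M),
  (forall w, linear_on L w -> w x = 0) -> x = 0.
Proof.
move=> syz dann M L x wx.
have [m [n [A [e [Ae es ew]]]]] := linear_on_matrix L [:: x].
have [i ei] := es x (mem_head _ _).
have [u uA|v vE] :=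
  @extend_functional R syz dann n m A^T (delta_mx i 0).
  have [|w wL we] := ew u^T.
    by apply: trmx_inj; rewrite trmx_mul trmxK uA trmx0.
  rewrite -colE; apply/matrixP => j k; rewrite !ord1 !mxE.
  by have := wx w wL; rewrite -ei we mxE.
transitivity (\sum_j (delta_mx i 0 : 'cV[R]_n) j 0 *: e j).
  rewrite (bigD1 i) //= mxE !eqxx scale1r big1 ?addr0 // => j ji.
  by rewrite mxE (negPf ji) scale0r.
rewrite vE; under eq_bigr do rewrite mxE scaler_suml.
rewrite exchange_big big1 //= => k _.
under eq_bigr do rewrite mxE mulrC -scalerA.
by rewrite -scaler_sumr Ae scaler0.
Qed.

Lemma germ_module (M : lmodType R) :
  exists (F : lmodType R) (germ : {linear ((M -> R) -> R^o) -> F}),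
  (forall y, exists f, germ f = y) /\
  forall f, germ f = 0 <-> exists L, forall w, linear_on L w -> f w = 0.
Proof.
have [||U UP] := @submod_of_pred R ((M -> R) -> R^o)
    (fun f => exists L, forall w, linear_on L w -> f w = 0).
- by exists [::].
- move=> a f g [L fL] [L' gL']; exists (L ++ L') => w /linear_on_cat[wL wL'].
  have -> : (a *: f + g) w = a * f w + g w by [].
  by rewrite fL // gL' // mulr0 addr0.
have [F [germ [gsurj gker]]] := quotient_module U.
by exists F, germ; split=> // f; rewrite gker UP.
Qed.

(** The module of germs is flat by coherence alone: the generators [G] of the
    syzygies of the transpose of [A] serve at every point [w], so the choice of
    coefficients [z w] at each point gives germs [y].  The double annihilator
    condition makes the evaluation map injective. *)
Lemma embeds_in_flat (M : lmodType R) :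
  fg_syzygies R -> double_ann R ->
  exists2 F : lmodType R, flat F & embeds M F.
Proof.
move=> syz dann.
have [F [germ [germ_surj germ_eq0]]] := germ_module M.
exists F.
  apply: factors_relations_flat => m n A x Ax.
  have /choice[f fE] i := germ_surj (x i).
  have /choice[L LP] k : exists L, forall w, linear_on L w ->
      \sum_i A k i * f i w = 0.
    have /germ_eq0[L LP] : germ (\sum_i A k i *: f i) = 0.
      rewrite -[RHS](Ax k) linear_sum; apply: eq_bigr => i _.
      by rewrite linearZ_LR fE.
    by exists L => w /LP; rewrite fct_sumE.
  have [q [G GP]] := fg_syzygies_mx syz A^T.
  pose L0 := flatten [seq L k | k <- enum 'I_m].
  have L0P w k : linear_on L0 w -> linear_on (L k) w.
    move=> wL a y z ayz; apply: wL; apply/flattenP; exists (L k) => //.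
    by apply: map_f; rewrite mem_enum.
  have /choice[z zE] w : exists z : 'rV[R]_q,
      linear_on L0 w -> \row_i f i w = z *m G.
    have [wL|] := pselect (linear_on L0 w); last by exists 0.
    have /GP[z zE] : (\row_i f i w : 'rV[R]_n) *m A^T = 0.
      apply/matrixP => a k; rewrite !ord1 !mxE.
      rewrite -[RHS](LP k w (L0P w k wL)); apply: eq_bigr => i _.
      by rewrite !mxE mulrC.
    by exists z.
  exists q, G^T, (fun j => germ (fun w => z w 0 j)); split=> [i|].
    apply/eqP; rewrite -fE -subr_eq0; apply/eqP.
    under eq_bigr do rewrite -linearZ_LR.
    rewrite -linear_sum -linearB; apply/germ_eq0; exists L0 => w wL.
    have /matrixP/(_ 0 i) := zE w wL; rewrite fct_sumE !mxE => fiw.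
    change (f i w - \sum_j G^T i j * z w 0 j = 0); rewrite fiw.
    by apply/eqP; rewrite subr_eq0; apply/eqP/eq_bigr => j _; rewrite mxE mulrC.
  by apply: trmx_inj; rewrite trmx_mul trmxK trmx0 (gens_mulmx0 GP).
have [|h hE] := @linear_map R M F (fun x => germ (fun w => w x)).
  move=> a x y; apply/eqP; rewrite -linearP -subr_eq0 -linearB.
  apply/eqP/germ_eq0.
  exists [:: (a, x, y)] => w /(_ _ _ _ (mem_head _ _)) wE.
  by apply/eqP; rewrite subr_eq0; apply/eqP.
exists h => x y xy; apply/eqP; rewrite -subr_eq0; apply/eqP.
have /germ_eq0[L LP] : germ (fun w => w (x - y)) = 0.
  by rewrite -hE linearB xy subrr.
exact: (@linear_on_separates syz dann M L _ LP).
Qed.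

End Germs.

(** * The equivalence *)

Theorem proposition1p1 (R : comPzRingType) :
  [<-> semiregular R;
       forall M : lmodType R, finitely_presented M -> embeds_in_free M;
       forall M : lmodType R, finitely_presented M -> cyclic_module M ->
         embeds_in_free M;
       coherent R /\
         forall I : ideal R, fg_ideal I -> ann (ann (ideal_set I)) = ideal_set I].
Proof.
tfae=> [sr M Mfp|emb M Mfp _|emb|[coh dann] M].
- have [F /flat_factors_relations Ffac MF] := sr M.
  have [p Mp] := factors_relations_embeds Ffac MF Mfp.
  by exists 'rV[R]_p; first exact: row_space_free.
- exact: emb.
- have annI := cyclic_embeds_annihilator_ideals emb.
  split; first exact/fg_syzygies_coherent/annihilator_ideals_fg_syzygies.
  exact/double_annP/annihilator_ideals_double_ann.
- by apply: embeds_in_flat; [exact: coherent_fg_syzygies|exact/double_annP].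
Qed.
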